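(* Let $\overline{\mathbb P}$ be a probability measure on $\Omega_+^2$ such that $\overline{\mathbb P}[\{(\omega_1,\omega_2): \omega_1\le\omega_2\}]=1$ and such that, for $i=1,2$, $(\omega_i(x))_{x\ge0}$ is stationary and ergodic under $\overline{\mathbb P}$. For $i=1,2$ let $v_i$ denote the $\overline{\mathbb P}\times P_{0,\omega_i}$-a.s. constant limit of $X_n/n$ as $n\to\infty$. Then $v_1\le v_2$.
   Context: Cookie environments: $\Omega_+=([1/2,1]^{\mathbb N})^{\mathbb Z}$, $\omega(x)=(\omega(x,i))_{i\ge1}$; $\omega_1\le\omega_2$ means $\omega_1(x,i)\le\omega_2(x,i)$ for all $x\in\mathbb Z,i\ge1$. $P_{x,\omega}$ is the law of the nearest-neighbor process $(X_n)_{n\ge0}$ with $X_0=x$ which, on its $i$-th visit to site $z$, jumps to $z+1$ with probability $\omega(z,i)$ and to $z-1$ otherwise. $\overline{\mathbb P}\times P_{0,\omega_i}$ denotes the measure $\overline{\mathbb E}[P_{0,\omega_i}[\cdot]]$. (Under stationarity and ergodicity of the environment, $X_n/n$ converges almost surely to a deterministic constant.) *)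

(* Defs.v *)
From HB Require Import structures.
From mathcomp Require Import all_boot all_order all_algebra.
From mathcomp Require Import all_classical all_reals all_analysis.

Set Implicit Arguments.
Unset Strict Implicit.
Unset Printing Implicit Defensive.

Import Order.TTheory GRing.Theory Num.Theory.
Import numFieldNormedType.Exports.
Local Open Scope classical_set_scope.
Local Open Scope ring_scope.


Definition coord_sets (R : realType) (I : Type) : set (set (I -> R)) :=
  [set A | exists (i : I) (B : set R), measurable B /\ A = (fun f => f i) @^-1` B].

(** Carrier types, equipped (classically) with choice and a point so that the
    generated sigma-algebras can be formed. *)
Definition envT (R : realType) := (int * nat -> R)%type.
HB.instance Definition _ (R : realType) := gen_eqMixin (envT R).
HB.instance Definition _ (R : realType) := gen_choiceMixin (envT R).
HB.instance Definition _ (R : realType) := isPointed.Build (envT R) (fun=> 0).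

Definition seqT (R : realType) := (nat * nat -> R)%type.
HB.instance Definition _ (R : realType) := gen_eqMixin (seqT R).
HB.instance Definition _ (R : realType) := gen_choiceMixin (seqT R).
HB.instance Definition _ (R : realType) := isPointed.Build (seqT R) (fun=> 0).

Definition pathT := (nat -> int)%type.
HB.instance Definition _ := gen_eqMixin pathT.
HB.instance Definition _ := gen_choiceMixin pathT.
HB.instance Definition _ := isPointed.Build pathT (fun=> 0%Z).

(** Environments: [omega (x, k)] is the probability to jump to the right at
    the (k+1)-th visit to site x (0-indexed visits: [k = i - 1] in the paper's
    notation [omega(x, i)], [i >= 1]). *)
Notation Env R := (@g_sigma_algebraType (envT R) (@coord_sets R (int * nat)%type)).

Definition in_Omega_plus {R : realType} (w : Env R) : Prop :=
  forall x k, 2^-1 <= w (x, k) <= 1.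

Definition env_le {R : realType} (w1 w2 : Env R) : Prop := forall x k, w1 (x, k) <= w2 (x, k).

Notation SeqEnv R := (@g_sigma_algebraType (seqT R) (@coord_sets R (nat * nat)%type)).

Definition half_env {R : realType} (w : Env R) : SeqEnv R := fun xk => w (Posz xk.1, xk.2).
Definition shift_seq {R : realType} (s : SeqEnv R) : SeqEnv R := fun xk => s (xk.1.+1, xk.2).

Definition stationary_half {R : realType} {d} {T : measurableType d} (P : probability T R)
    (w : T -> Env R) : Prop :=
  forall B : set (SeqEnv R), measurable B ->
    P [set t | shift_seq (half_env (w t)) \in B] =
    P [set t | half_env (w t) \in B].

Definition ergodic_half {R : realType} {d} {T : measurableType d} (P : probability T R)
    (w : T -> Env R) : Prop :=
  forall B : set (SeqEnv R), measurable B -> shift_seq @^-1` B = B ->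
    P [set t | half_env (w t) \in B] = 0%E \/
    P [set t | half_env (w t) \in B] = 1%E.

Definition path_sets : set (set (nat -> int)) :=
  [set A | exists (m : nat) (B : set int), A = (fun X => X m) @^-1` B].

Notation PathSp := (@g_sigma_algebraType pathT path_sets).

(** Transition probability of the cookie walk: [past] = X_0, ..., X_{n-1},
    current position z = X_n; the number of earlier visits to z is
    [count (pred1 z) past], so the current visit is visit number
    [count (pred1 z) past + 1]. *)
Definition erw_step {R : realType} (w : Env R) (past : seq int) (z y : int) : R :=
  let c := count (pred1 z) past in
  if y == z + 1 then w (z, c)
  else if y == z - 1 then 1 - w (z, c)
  else 0.

Definition cyl_prob {R : realType} (w : Env R) (Y : nat -> int) (n : nat) : R :=
  (Y 0%N == 0)%:R *
  \prod_(m < n) erw_step w (map Y (iota 0 m)) (Y m) (Y m.+1).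

(** [Q] is the law P_{0,omega} of the excited (cookie) random walk on
    path space (characterized by its finite-dimensional distributions,
    which determine it uniquely). *)
Definition is_ERW_law {R : realType} (w : Env R) (Q : probability PathSp R) : Prop :=
  forall (Y : nat -> int) (n : nat),
    Q [set X : PathSp | forall m, (m <= n)%N -> X m = Y m] = (cyl_prob w Y n)%:E.

Definition speed_event {R : realType} (v : R) : set PathSp :=
  [set X : PathSp | (fun n : nat => (X n)%:~R / n%:R : R) @ \oo --> v].

(* Main.v *)
Require Import Defs.
From HB Require Import structures.
From mathcomp Require Import all_boot all_order all_algebra.
From mathcomp Require Import all_classical all_reals all_analysis.
From mathcomp Require Import zify ring lra.

Set Implicit Arguments.
Unset Strict Implicit.
Unset Printing Implicit Defensive.

Import Order.TTheory GRing.Theory Num.Theory.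
Import numFieldNormedType.Exports.
Local Open Scope classical_set_scope.
Local Open Scope ring_scope.

(** The comparison is quenched: it holds separately for almost every pair of
    environments.

    For a finite horizon [n], the probability that the walk reaches level [K]
    by time [n] is affine in each [w (x, i)] (a path uses each cookie at most
    once), so its monotonicity in [w] reduces to 0/1-valued environments, where
    the walk follows deterministic stacks of arrows. There, let [X] be at or
    above [K] at time [s] and suppose that [Y], whose stacks have more right
    arrows, stays below [K]. Counting crossings of the edges downwards from [K]
    shows that [Y] has visited each site at most as often as [X]; both have made
    [s] visits in all, so the numbers agree, and then [Y] has jumped right from
    [K - 1].

    If [v2 < v1], pick [c] strictly between them. The walk is a submartingale,
    so [v2 >= 0] and [c > 0]; for large [n] the first walk has most likely
    reached [c * n] by time [n] and the second has not, a contradiction. *)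

(** * Walks driven by deterministic stacks of arrows *)

Lemma map_iotaS (T : Type) (X : nat -> T) t :
  map X (iota 0 t.+1) = rcons (map X (iota 0 t)) (X t).
Proof. by rewrite -addn1 iotaD map_cat cats1. Qed.

Definition stack_walk (e : int * nat -> bool) (X : nat -> int) : Prop :=
  X 0%N = 0 /\ forall t, X t.+1 =
    X t + (if e (X t, count (pred1 (X t)) (map X (iota 0 t))) then 1 else -1).

Definition visits (X : nat -> int) (t : nat) (z : int) : nat :=
  count (pred1 z) (map X (iota 0 t)).

Definition rights (e : int * nat -> bool) (X : nat -> int) (t : nat) (z : int) :=
  count (fun i => e (z, i)) (iota 0 (visits X t z)).

Definition lefts (e : int * nat -> bool) (X : nat -> int) (t : nat) (z : int) :=
  count (fun i => ~~ e (z, i)) (iota 0 (visits X t z)).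

Lemma visitsS X t z : visits X t.+1 z = (visits X t z + (X t == z))%N.
Proof. by rewrite /visits map_iotaS -cats1 count_cat /= addn0. Qed.

Lemma count_iotaS (a : pred nat) n : count a (iota 0 n.+1) = (count a (iota 0 n) + a n)%N.
Proof. by rewrite -addn1 iotaD count_cat /= addn0. Qed.

Lemma visits_eq0 X t z : (forall m, (m < t)%N -> X m != z) -> visits X t z = 0%N.
Proof.
move=> Xz; apply/eqP; rewrite -leqn0 leqNgt -has_count; apply/hasPn => y.
by move=> /mapP[m]; rewrite mem_iota /= add0n => /Xz mz ->.
Qed.

Lemma rightsS e X t z :
  rights e X t.+1 z = (rights e X t z + (X t == z) * e (z, visits X t z))%N.
Proof.
rewrite /rights visitsS; case: eqP => _; last by rewrite mul0n !addn0.
by rewrite addn1 count_iotaS mul1n.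
Qed.

Lemma leftsS e X t z :
  lefts e X t.+1 z = (lefts e X t z + (X t == z) * ~~ e (z, visits X t z))%N.
Proof.
rewrite /lefts visitsS; case: eqP => _; last by rewrite mul0n !addn0.
by rewrite addn1 count_iotaS mul1n.
Qed.

(** Net crossings of the edge between [z] and [z + 1]: right minus left crossings are determined by
    the sides on which the walk starts and stands at time [t]. *)
Lemma stack_walk_flow e X t z : stack_walk e X ->
  (rights e X t z + (X t <= z)%R)%N = (lefts e X t (z + 1) + (0 <= z)%R)%N.
Proof.
move=> [X0 XS]; elim: t => [|t IHt]; first by rewrite X0 /rights /lefts /visits.
rewrite rightsS leftsS XS -/(visits X t (X t)).
have [Xz|Xz] := eqVneq (X t) z.
  rewrite Xz in IHt *; case: (e _) IHt; lia.
have [Xz1|Xz1] := eqVneq (X t) (z + 1).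
  rewrite Xz1 mul0n in IHt *; case: (e _) IHt; lia.
rewrite !mul0n; case: (e _) IHt; lia.
Qed.

(** Steps have length one, so a walk now strictly right of [z] left [z] rightwards at its last
    visit, whose 0-based arrow index is [(visits X t z).-1]. *)
Lemma stack_walk_last_right e X t z : stack_walk e X ->
  z < X t -> (0 < visits X t z)%N -> e (z, (visits X t z).-1).
Proof.
move=> [X0 XS]; elim: t => [//|t IHt].
rewrite XS visitsS -/(visits X t (X t)).
have [Xz|Xz] := eqVneq (X t) z.
  rewrite Xz addn1 /=; case: (e _) => //; lia.
rewrite addn0 => Xtz; apply: IHt; move: Xtz; case: (e _); lia.
Qed.

(* Downward induction on the site: visits to [z] are determined by the number
   of right jumps from [z], i.e. by the number of left jumps from [z + 1]. *)
Lemma visits_le (e e' : int * nat -> bool) X Y s (K : int) : (forall p, e p -> e' p) ->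
  stack_walk e X -> stack_walk e' Y -> K <= X s ->
  (forall m, (m <= s)%N -> Y m < K) ->
  forall z, (visits Y s z <= visits X s z)%N.
Proof.
move=> ee' wX wY XK YK.
have base z : K <= z -> visits Y s z = 0%N.
  move=> Kz; apply: visits_eq0 => m /ltnW /YK mK; lia.
suff H (d : nat) z : z = K - d%:Z -> (visits Y s z <= visits X s z)%N.
  move=> z; have [Kz|zK] := lerP K z; first by rewrite base.
  apply: (H `|K - z|%N); lia.
elim: d z => [|d IHd] z zK; first by rewrite base //; lia.
have /IHd vz1 : z + 1 = K - d%:Z by lia.
rewrite leqNgt; apply/negP => vz.
have lle : (lefts e' Y s (z + 1) <= lefts e X s (z + 1))%N.
  rewrite /lefts -(subnKC vz1) iotaD count_cat.
  apply: leq_trans (leq_addr _ _).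
  by apply: sub_count => i; apply: contra; apply: ee'.
have rle n : (count (fun i => e (z, i)) (iota 0 n)
    <= count (fun i => e' (z, i)) (iota 0 n))%N.
  by apply: sub_count => i; apply: ee'.
have := stack_walk_flow s z wX; have := stack_walk_flow s z wY.
have := stack_walk_last_right (t := s) (z := z) wY; rewrite (leq_trans _ vz)//.
(* With [Y] visiting [z] more often, its last arrow there lies beyond those used by [X]. The flow
   identities then force that arrow to point left and [Y s] to lie right of [z], against
   [stack_walk_last_right]. *)
have rY : (rights e X s z + e' (z, (visits Y s z).-1) <= rights e' Y s z)%N.
  rewrite /rights -{2}(prednK (leq_trans (ltn0Sn _) vz)) count_iotaS leq_add2r.
  apply: leq_trans (rle _) _.
  have vz' : (visits X s z <= (visits Y s z).-1)%N by lia.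
  by rewrite -(subnKC vz') iotaD count_cat leq_addr.
case: (e' _) rY => rY; lia.
Qed.

Lemma stack_walk_hit_mono (e e' : int * nat -> bool) X Y s (K : int) : (forall p, e p -> e' p) ->
  stack_walk e X -> stack_walk e' Y -> 0 < K -> K <= X s ->
  exists2 m, (m <= s)%N & K <= Y m.
Proof.
move=> ee' wX wY K0 XK.
have [/hasP[y /mapP[m]]|/hasPn noY] := boolP (has (fun y => K <= y) (map Y (iota 0 s.+1))).
  by rewrite mem_iota /= add0n ltnS => ms -> KY; exists m.
have YK m : (m <= s)%N -> Y m < K.
  by move=> ms; rewrite ltNge; apply: noY; apply: map_f; rewrite mem_iota.
exfalso; have vle := visits_le ee' wX wY XK YK.
(* Both lists of visited sites have length [s], so inclusion as multisets is equality. *)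
have veq z : visits Y s z = visits X s z.
  have /count_subseqP[r rX pr] : forall z, (count_mem z (map Y (iota 0 s))
    <= count_mem z (map X (iota 0 s)))%N by exact: vle.
  have := size_subseq_leqif rX; rewrite -(perm_size pr) !size_map => -[_].
  by rewrite eqxx /visits => /esym/eqP <-; apply/permP.
have := stack_walk_flow s (K - 1) wX; have := stack_walk_flow s (K - 1) wY.
(* [Y] never visits [K], so the flow across the edge below [K] leaves [Y] no right jump from
   [K - 1], while [X] needs at least one. *)
have lY0 : lefts e' Y s K = 0%N.
  rewrite /lefts (_ : visits Y s K = 0)%N//.
  by apply: visits_eq0 => m /ltnW /YK mK; lia.
have YsK := YK s (leqnn s).
have : (rights e X s (K - 1) <= rights e' Y s (K - 1))%N.
  by rewrite /rights veq; apply: sub_count => i; apply: ee'.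
rewrite subrK lY0; lia.
Qed.

Fixpoint stack_state (e : int * nat -> bool) (t : nat) : seq int * int :=
  if t is t'.+1 then
    let: (past, z) := stack_state e t' in
    (rcons past z, z + (if e (z, count (pred1 z) past) then 1 else -1))
  else ([::], 0).

Lemma stack_walk_exists e : exists X, stack_walk e X.
Proof.
exists (fun t => (stack_state e t).2); split=> // t.
have -> : map (fun t => (stack_state e t).2) (iota 0 t) = (stack_state e t).1.
  elim: t => // t IHt; rewrite map_iotaS IHt /=.
  by case: (stack_state e t).
by rewrite /=; case: (stack_state e t).
Qed.

(** * Reduction to 0/1-valued environments *)

Definition update (I : eqType) (T : Type) (w : I -> T) (p : I) (b : T) : I -> T :=
  fun q => if q == p then b else w q.

(** Induction on [S], which lists the coordinates where values strictly between 0 and 1 may remain: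
    [F] interpolates between its values with the head coordinate set to 0 and to 1, where the
    induction hypothesis applies. *)
Lemma multiaffine_mono (R : realDomainType) (I : eqType) (F : (I -> R) -> R) :
  (forall w p, F w = w p * F (update w p 1) + (1 - w p) * F (update w p 0)) ->
  (forall b b' : I -> bool, (forall p, b p -> b' p) ->
    F (fun p => (b p)%:R) <= F (fun p => (b' p)%:R)) ->
  forall (S : seq I) w w', (forall p, 0 <= w p <= w' p) -> (forall p, w' p <= 1) ->
  (forall p, p \notin S -> w p \in [:: 0; 1]) ->
  (forall p, p \notin S -> w' p \in [:: 0; 1]) -> F w <= F w'.
Proof.
move=> affF monoF; elim=> [|p S IHS] w w' ww' w'1 wS w'S.
  have E (u : I -> R) : (forall p, p \notin [::] -> u p \in [:: 0; 1]) ->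
      u = fun p => (u p == 1)%:R.
    move=> uS; apply/funext => p; have := uS p isT.
    rewrite !inE => /orP[]/eqP ->; last by rewrite eqxx.
    by rewrite eq_sym oner_eq0.
  rewrite (E w)// (E w')//; apply: monoF => p /eqP wp.
  by have := ww' p; rewrite wp => /andP[_ ?]; rewrite eq_le w'1.
have upd u b : b \in [:: 0; 1] -> (forall q, q \notin p :: S -> u q \in [:: 0; 1]) ->
    forall q, q \notin S -> update u p b q \in [:: 0; 1].
  move=> bP uS q qS; rewrite /update; case: eqP => // /eqP qp.
  by apply: uS; rewrite inE negb_or qp.
have H0 : (0 : R) \in [:: 0; 1] by rewrite !inE eqxx.
have H1 : (1 : R) \in [:: 0; 1] by rewrite !inE eqxx orbT.
have lef (b b' : bool) : b ==> b' ->
    (forall q, 0 <= update w p b%:R q <= update w' p b'%:R q) /\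
    (forall q, update w' p b'%:R q <= 1).
  move=> bb'; split=> q; rewrite /update; case: eqP => // _.
  - by rewrite ler0n ler_nat; case: b b' bb' => [] [].
  - by case: (b'); rewrite /= ?lexx ?ler01.
have [l11 l12] := lef true true isT; have [l01 l02] := lef false false isT.
have a0b0 : F (update w p 0) <= F (update w' p 0) by apply: IHS => //; apply: upd.
have a1b1 : F (update w p 1) <= F (update w' p 1) by apply: IHS => //; apply: upd.
have a0a1 : F (update w p 0) <= F (update w p 1).
  apply: IHS => //; try exact: upd.
  - move=> q; rewrite /update; case: eqP => // _; first by rewrite lexx ler01.
    by have /andP[-> _] := ww' q; rewrite lexx.
  - move=> q; rewrite /update; case: eqP => // _.
    by have /andP[_ /le_trans] := ww' q; apply.
rewrite (affF w p) (affF w' p).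
have /andP[w0 wp] := ww' p; have w'p := w'1 p.
(* First the weight moves from [w p] up to [w' p], using [a0a1]; then the endpoints are compared by
   [a0b0] and [a1b1]. *)
apply: (@le_trans _ _ (w' p * F (update w p 1) + (1 - w' p) * F (update w p 0))).
  rewrite -subr_ge0.
  rewrite (_ : _ - _ = (w' p - w p) * (F (update w p 1) - F (update w p 0))); last by ring.
  by apply: mulr_ge0; rewrite subr_ge0.
apply: lerD; apply: ler_wpM2l => //; first exact: le_trans wp.
by rewrite subr_ge0.
Qed.

(** * Finite-horizon path probabilities *)

(** For [w] valued in [0,1], the conditional probability, given the positions [past] followed by
    [z], that the trajectory extended by [n] further steps satisfies [h]. *)
Fixpoint path_prob (R : realFieldType) (w : int * nat -> R) (h : pred (seq int))
    (n : nat) (past : seq int) (z : int) : R :=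
  if n is n'.+1 then
    w (z, count (pred1 z) past) * path_prob w h n' (rcons past z) (z + 1) +
    (1 - w (z, count (pred1 z) past)) * path_prob w h n' (rcons past z) (z - 1)
  else (h (rcons past z))%:R.

Lemma count_rcons1 (x z : int) s :
  count (pred1 x) (rcons s z) = (count (pred1 x) s + (z == x))%N.
Proof. by rewrite -cats1 count_cat /= addn0. Qed.

(** The lower bound on [i] discards cookies already used, which yields affinity in each cookie; the
    upper bounds leave a finite box, as [multiaffine_mono] requires. *)
Lemma eq_path_prob (R : realFieldType) (w w' : int * nat -> R) h n past z :
  (forall x i, (`|x| <= `|z| + n)%N -> (count (pred1 x) past <= i < size past + n)%N ->
    w (x, i) = w' (x, i)) ->
  path_prob w h n past z = path_prob w' h n past z.
Proof.
elim: n past z => [//|n IHn] past z ww' /=.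
rewrite ww'; last 2 first.
- by rewrite leq_addr.
- by rewrite leqnn addnS ltnS (leq_trans (count_size _ _))// leq_addr.
by congr (_ * _ + _ * _); apply: IHn => x i xn;
  rewrite size_rcons count_rcons1 => /andP[ci iS]; apply: ww'; lia.
Qed.

Lemma path_prob_affine (R : realFieldType) (w : int * nat -> R) h n past z p :
  path_prob w h n past z =
  w p * path_prob (update w p 1) h n past z +
  (1 - w p) * path_prob (update w p 0) h n past z.
Proof.
elim: n past z => [|n IHn] past z /=; first by ring.
have [->|pz] := eqVneq p (z, count (pred1 z) past).
  (* The current cookie is consumed by this step, so the continuation no longer depends on it. *)
  have upd b y : path_prob (update w (z, count (pred1 z) past) b) h n (rcons past z) y =
      path_prob w h n (rcons past z) y.
    apply: eq_path_prob => x i _; rewrite count_rcons1 /update => /andP[ci _].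
    by case: eqP => // -[xz ic]; move: ci; rewrite xz ic eqxx addn1 ltnn.
  by rewrite !upd /update eqxx; ring.
rewrite (IHn _ (z + 1)) (IHn _ (z - 1)) /update eq_sym (negbTE pz); ring.
Qed.

Lemma path_prob_stack_walk (R : realFieldType) (e : int * nat -> bool) X h n m :
  stack_walk e X ->
  path_prob (fun p => (e p)%:R : R) h n (map X (iota 0 m)) (X m) =
  (h (map X (iota 0 (m + n).+1)))%:R.
Proof.
move=> [X0 XS].
elim: n m => [|n IHn] m; first by rewrite /= -map_iotaS addn0.
move: (IHn m.+1); rewrite addSnnS => <-; rewrite [LHS]/= -map_iotaS XS.
by case: (e _); rewrite ?subr0 ?subrr ?mul0r ?mul1r ?add0r ?addr0.
Qed.

Lemma path_prob_hit_mono (R : realFieldType) (w w' : int * nat -> R) (K : int) n :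
  (forall p, 0 <= w p <= w' p) -> (forall p, w' p <= 1) -> 0 < K ->
  path_prob w (has (fun x => K <= x)) n [::] 0 <=
  path_prob w' (has (fun x => K <= x)) n [::] 0.
Proof.
move=> ww' w'1 K0; set h := has _.
(* [S] is a box containing every cookie reachable from 0 within [n] steps. Setting the others to 0
   keeps the probability and makes the environments 0/1-valued off [S]. *)
pose S := [seq (x, i) | x <- [seq k%:Z - n%:Z | k <- iota 0 n.*2.+1], i <- iota 0 n].
pose tr (u : int * nat -> R) p := if p \in S then u p else 0.
have trE u : path_prob u h n [::] 0 = path_prob (tr u) h n [::] 0.
  apply: eq_path_prob => x i xn /andP[_ iS]; rewrite /tr ifT//.
  apply/allpairsP; exists (x, i); split; [|by rewrite mem_iota|by []].
  by apply/mapP; exists (absz (x + n%:Z)); rewrite ?mem_iota /=; lia.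
rewrite (trE w) (trE w').
apply: (multiaffine_mono (F := fun u => path_prob u h n [::] 0)) (S) _ _ _ _ _ _.
- by move=> u p; apply: path_prob_affine.
- move=> b b' bb'; have [X wX] := stack_walk_exists b.
  have [Y wY] := stack_walk_exists b'.
  have := path_prob_stack_walk R h n 0 wX; rewrite wX.1 => ->.
  have := path_prob_stack_walk R h n 0 wY; rewrite wY.1 => ->.
  rewrite ler_nat add0n; have [/hasP[x /mapP[s]]|//] := boolP (h (map X _)).
  rewrite mem_iota add0n ltnS => sn -> KX.
  have [m ms KY] := stack_walk_hit_mono bb' wX wY K0 KX.
  suff -> : h (map Y (iota 0 n.+1)) by [].
  apply/hasP; exists (Y m) => //; apply: map_f.
  by rewrite mem_iota /= add0n ltnS (leq_trans ms).
- by move=> p; rewrite /tr; case: ifP; rewrite ?lexx.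
- by move=> p; rewrite /tr; case: ifP; rewrite ?ler01.
- by move=> p pS; rewrite /tr (negbTE pS) !inE eqxx.
- by move=> p pS; rewrite /tr (negbTE pS) !inE eqxx.
Qed.

(* [z |-> (z + r) / (N + r)] is increasing, hence submartingale along the walk,
   and below the indicator of [-r < z] on [z <= N]. *)
Lemma path_prob_last_ge (R : realFieldType) (w : int * nat -> R) (r N : R) n past z :
  (forall p, 2^-1 <= w p <= 1) -> 0 < N + r -> z%:~R + n%:R <= N ->
  (z%:~R + r) / (N + r) <=
  path_prob w (fun s => - r < (last 0 s)%:~R) n past z.
Proof.
move=> w1 Nr; elim: n past z => [|n IHn] past z zN /=.
  rewrite last_rcons; case: ltP => zr /=.
    by rewrite ler_pdivrMr// mul1r; move: zN; rewrite addr0; lra.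
  by rewrite ler_pdivrMr// mul0r; lra.
have := w1 (z, count (pred1 z) past); set a := w _ => /andP[a0 a1].
have zN1 : (z + 1)%:~R + n%:R <= N.
  by move: zN; rewrite -natr1 intrD; lra.
have zN2 : (z - 1)%:~R + n%:R <= N.
  by move: zN1; rewrite intrB intrD; lra.
apply: (@le_trans _ _ (a * (((z + 1)%:~R + r) / (N + r)) +
    (1 - a) * (((z - 1)%:~R + r) / (N + r)))).
  rewrite !mulrA -mulrDl ler_pM2r ?invr_gt0// intrB intrD; lra.
apply: lerD; apply: ler_wpM2l; try exact: IHn; lra.
Qed.

(** * Events on path space and the law of the walk *)

Lemma measurable_position m (B : set int) : measurable [set X : PathSp | B (X m)].
Proof. by apply: sub_sigma_algebra; exists m, B. Qed.

(** There are countably many finite integer sequences, so the event is a countable union over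
    possible prefixes. *)
Lemma measurable_prefix (h : pred (seq int)) n :
  measurable [set X : PathSp | h (map X (iota 0 n))].
Proof.
pose F (s : seq int) : set PathSp :=
  [set X : PathSp | h s /\ size s = n] `&`
  \bigcap_(i in [set i | (i < n)%N]) [set X : PathSp | X i = nth 0 s i].
rewrite (_ : [set _ | _] = \bigcup_s F s).
  apply: countable_bigcupT_measurable; first exact: countableP.
  move=> s; apply: measurableI.
    have [hs|hs] := pselect (h s /\ size s = n).
      by rewrite (_ : [set _ | _] = setT)//; apply/seteqP; split.
    by rewrite (_ : [set _ | _] = set0)//; apply/seteqP; split.
  apply: bigcap_measurableType => i _.
  exact: (measurable_position i [set nth 0 s i]).
apply/seteqP; split=> [X hX|X [s _ [[hs ss] Xs]]].
  exists (map X (iota 0 n)) => //; split.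
    by split=> //; rewrite size_map size_iota.
  by move=> i ni /=; rewrite (nth_map 0%N) ?size_iota// nth_iota.
rewrite /= (_ : map X _ = s)//; apply: (@eq_from_nth _ 0).
  by rewrite size_map size_iota.
move=> i; rewrite size_map size_iota => ni.
by rewrite (nth_map 0%N) ?size_iota// nth_iota// Xs.
Qed.

Definition cylinder (Y : nat -> int) (n : nat) : set PathSp :=
  [set X : PathSp | forall m, (m <= n)%N -> X m = Y m].

Lemma measurable_cylinder Y n : measurable (cylinder Y n).
Proof.
rewrite (_ : cylinder Y n =
    \bigcap_(i in [set i | (i <= n)%N]) [set X : PathSp | X i = Y i]).
  apply: bigcap_measurableType => i _.
  exact: (measurable_position i [set Y i]).
by apply/seteqP; split.
Qed.

(** The mass identity makes [C] minus both pieces null. This serves to split a cylinder by the next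
    jump, all jumps other than to a neighbor having probability zero. *)
Lemma measure_split_ae d (T : measurableType d) (R : realType)
    (P : probability T R) (C B D A : set T) :
  measurable A -> measurable B -> measurable C -> measurable D ->
  B `<=` C -> D `<=` C -> B `&` D = set0 -> (P C = P B + P D)%E ->
  (P (C `&` A) = P (B `&` A) + P (D `&` A))%E.
Proof.
move=> mA mB mC mD BC DC BD0 PC.
have mBD : measurable (B `|` D) by exact: measurableU.
have mCA : measurable (C `&` A) by exact: measurableI.
have PBD : (P (B `|` D) = P C)%E by rewrite measureU// PC.
have rest0 : P (C `\` (B `|` D)) = 0%E.
  have -> : P (C `\` (B `|` D)) = (P C - P (B `|` D))%E.
    have CBD : C `&` (B `|` D) = B `|` D.
      by apply/seteqP; split=> [x []//|x [Bx|Dx]]; split; [exact: BC|left|exact: DC|right].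
    by rewrite -[in RHS]CBD; apply: measureD => //; rewrite ltey_eq fin_num_measure.
  by rewrite PBD subee// fin_num_measure.
have -> : (P (C `&` A) = P ((C `&` A) `\` (B `|` D)) + P ((C `&` A) `&` (B `|` D)))%E.
  exact: measureDI.
have -> : P ((C `&` A) `\` (B `|` D)) = 0%E.
  apply/eqP; rewrite eq_le measure_ge0 andbT -rest0.
  apply: le_measure; rewrite ?inE; try exact: measurableD.
  by move=> x [[Cx _] nBD].
rewrite add0e -measureU; try exact: measurableI; last first.
  by rewrite setIACA BD0 set0I.
congr (P _); apply/seteqP; split=> x.
  by move=> [[Cx Ax] [Bx|Dx]]; [left|right].
by move=> [[Bx Ax]|[Dx Ax]]; split; [split=> //; exact: BC|left|split=> //; exact: DC|right].
Qed.

Section erw.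
Context {R : realType} (w : Env R) (Q : probability PathSp R).
Context (lawQ : is_ERW_law w Q).

(** [is_ERW_law] speaks of cylinders around total functions, so a one-step refinement is written by
    making [Y] constantly [y] after time [m]. *)
Let ext (Y : nat -> int) (m : nat) (y : int) k := if (k <= m)%N then Y k else y.

Let extE Y m y k : (k <= m)%N -> ext Y m y k = Y k.
Proof. by rewrite /ext => ->. Qed.

Let map_ext Y m y k : (k <= m.+1)%N -> map (ext Y m y) (iota 0 k) = map Y (iota 0 k).
Proof.
move=> km; apply/eq_in_map => i; rewrite mem_iota add0n /= => ik.
by rewrite extE// -ltnS (leq_trans ik).
Qed.

Let cyl_prob_ext Y m y : cyl_prob w (ext Y m y) m.+1 =
  cyl_prob w Y m * erw_step w (map Y (iota 0 m)) (Y m) y.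
Proof.
rewrite /cyl_prob big_ord_recr /= extE// mulrA; congr (_ * _ * _).
  apply: eq_bigr => i _; rewrite map_ext ?extE// ?(ltnW (ltn_ord i))//.
  exact: leqW (ltnW (ltn_ord i)).
by rewrite map_ext// extE// /ext ltnn.
Qed.

(** Bridge between [Q] and the recursion [path_prob]: each induction step splits the cylinder into
    its right and left extensions. *)
Lemma cylinder_prefix_prob (h : pred (seq int)) n m Y :
  Q (cylinder Y m `&` [set X : PathSp | h (map X (iota 0 (m + n).+1))]) =
  (cyl_prob w Y m * path_prob w h n (map Y (iota 0 m)) (Y m))%:E.
Proof.
elim: n m Y => [|n IHn] m Y.
  rewrite addn0 [path_prob _ _ _ _ _]/= -map_iotaS.
  have mapE (X : PathSp) : cylinder Y m X -> map X (iota 0 m.+1) = map Y (iota 0 m.+1).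
    move=> XY; apply/eq_in_map => i; rewrite mem_iota add0n ltnS => /andP[_].
    exact: XY.
  have [hY|hY] := boolP (h _).
    rewrite mulr1 -lawQ; congr (Q _); apply/seteqP; split=> [X []//|X XY].
    by split=> //; rewrite /mkset mapE.
  rewrite mulr0 (_ : _ `&` _ = set0) ?measure0//; apply/seteqP; split=> // X [XY].
  by rewrite /mkset mapE// (negbTE hY).
rewrite -addSnnS.
have sub y : cylinder (ext Y m y) m.+1 `<=` cylinder Y m.
  by move=> X XY k km; rewrite XY ?extE// leqW.
have stepr : erw_step w (map Y (iota 0 m)) (Y m) (Y m + 1) =
    w (Y m, count (pred1 (Y m)) (map Y (iota 0 m))) by rewrite /erw_step eqxx.
have stepl : erw_step w (map Y (iota 0 m)) (Y m) (Y m - 1) =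
    1 - w (Y m, count (pred1 (Y m)) (map Y (iota 0 m))).
  rewrite /erw_step eqxx ifF//; apply/eqP; lia.
rewrite (@measure_split_ae _ _ _ Q _ (cylinder (ext Y m (Y m + 1)) m.+1)
  (cylinder (ext Y m (Y m - 1)) m.+1)); try exact: measurable_cylinder.
- rewrite !IHn !cyl_prob_ext !map_ext// -EFinD map_iotaS /= stepr stepl.
  by rewrite /ext ltnn; congr EFin; ring.
- exact: measurable_prefix.
- exact: sub.
- exact: sub.
- apply/seteqP; split=> // X [/(_ m.+1 (leqnn _)) + /(_ m.+1 (leqnn _))].
  by rewrite /ext ltnn => ->; lia.
- rewrite /cylinder !lawQ !cyl_prob_ext stepr stepl -EFinD.
  by congr EFin; ring.
Qed.

Lemma prefix_prob (h : pred (seq int)) n :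
  Q [set X : PathSp | h (map X (iota 0 n.+1))] = (path_prob w h n [::] 0)%:E.
Proof.
have := cylinder_prefix_prob h n 0 (fun=> 0).
have c1 : cyl_prob w (fun=> 0) 0 = 1 by rewrite /cyl_prob big_ord0 eqxx mulr1.
rewrite c1 mul1r add0n => <-.
(* The walk starts at 0 almost surely, so the event may be cut down to this cylinder. *)
have Qc : Q (cylinder (fun=> 0) 0) = 1%E by rewrite /cylinder lawQ c1.
have mc := measurable_cylinder (fun=> 0) 0.
have mp := measurable_prefix h n.+1.
set E := [set X : PathSp | _] in mp *.
have -> : (Q E = Q (E `\` cylinder (fun=> 0%R) 0%N) + Q (E `&` cylinder (fun=> 0%R) 0%N))%E.
  exact: measureDI.
rewrite setIC [X in (X + _)%E](_ : _ = 0%E) ?add0e//.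
apply/eqP; rewrite eq_le measure_ge0 andbT.
apply: (@le_trans _ _ (Q (~` cylinder (fun=> 0) 0))).
  apply: le_measure; rewrite ?inE; [exact: measurableD|exact: measurableC|].
  by move=> X [].
by rewrite probability_setC// Qc subee.
Qed.

End erw.

(** * Comparison of speeds in fixed environments *)

Lemma near_prob_gt d (T : measurableType d) (R : realType) (P : probability T R)
    (A : nat -> set T) (S : set T) :
  measurable S -> P S = 1%E -> (forall n, measurable (A n)) ->
  (forall x, S x -> \forall n \near \oo, A n x) ->
  forall r : R, r < 1 -> \forall n \near \oo, r < fine (P (A n)).
Proof.
move=> mS PS mA SA r r1.
(* These sets increase to a union containing [S], so continuity from below applies. *)
pose G n := \bigcap_(k in [set k | (n <= k)%N]) A k.
have mG n : measurable (G n) by apply: bigcap_measurableType.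
have mUG : measurable (\bigcup_n G n) by apply: bigcupT_measurable.
have PUG : P (\bigcup_n G n) = 1%E.
  apply/eqP; rewrite eq_le probability_le1//= -PS.
  by apply: le_measure SA; rewrite inE.
have ndG : nondecreasing_seq G.
  by move=> m n mn; apply/subsetPset => x Gx k nk; apply: Gx; apply: leq_trans nk.
have : P \o G @ \oo --> P (\bigcup_n G n) by exact: nondecreasing_cvg_mu.
rewrite PUG => /fine_cvg /cvgr_gt /(_ _ r1).
apply: filterS => n /lt_le_trans; apply; apply: fine_le; rewrite ?fin_num_measure//.
by apply: le_measure; rewrite ?inE// => x; apply => /=.
Qed.

Lemma measurable_speed_event (R : realType) (v : R) : measurable (speed_event v).
Proof.
rewrite (_ : speed_event v = \bigcap_k \bigcup_N \bigcap_(n in [set n | (N <= n)%N])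
    [set X : PathSp | `|v - (X n)%:~R / n%:R| < k.+1%:R^-1]).
  apply: bigcapT_measurable => k; apply: bigcupT_measurable => N.
  apply: bigcap_measurableType => n _.
  exact: (measurable_position n [set z | `|v - z%:~R / n%:R| < k.+1%:R^-1]).
apply/seteqP; split=> [X /cvgrPdist_lt Xv k _|X Xv].
  have /Xv [N _ NX] : 0 < k.+1%:R^-1 :> R by rewrite invr_gt0 ltr0n.
  by exists N => // n; apply: NX.
apply/cvgrPdist_lt => e e0.
have [k _ /(_ k (leqnn k)) ke] := near_infty_natSinv_lt (PosNum e0).
have [N _ NX] := Xv k I; exists N => // n Nn.
by apply: lt_trans ke; apply: NX.
Qed.

Section quenched.
Context {R : realType}.

Let fineEFin (r : R) : fine r%:E = r. Proof. by []. Qed.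

(** A negative speed would make [X n > - a * n] unlikely for large [n], but the submartingale bound
    with [r = a * n] and [N = n] gives it probability at least [a / (1 + a)] at every positive
    horizon. *)
Lemma quenched_speed_ge0 (w : Env R) (Q : probability PathSp R) (v : R) :
  in_Omega_plus w -> is_ERW_law w Q -> Q (speed_event v) = 1%E -> 0 <= v.
Proof.
move=> w1 lawQ Qv; rewrite leNgt; apply/negP => v0.
pose a := - v / 2; have a0 : 0 < a by rewrite /a; lra.
pose h n : pred (seq int) := fun s => - (a * n%:R) < (last 0 s)%:~R.
pose B n : set PathSp := [set X : PathSp | h n (map X (iota 0 n.+1))].
have mB n : measurable (B n) by apply: measurable_prefix.
have ev (X : PathSp) : speed_event v X -> \forall n \near \oo, (~` B n) X.
  move=> /cvgr_lt /(_ (- a)) Xa; have va : v < - a by rewrite /a; lra.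
  near=> n; rewrite /B/setC /mkset /h map_iotaS last_rcons; apply/negP; rewrite -leNgt.
  have n0 : 0 < n%:R :> R by rewrite ltr0n; near: n; exists 1%N.
  by rewrite -mulNr -ler_pdivrMr// ltW//; near: n; apply: Xa.
have r1 : 1 - a / (1 + a) < 1 by rewrite gtrBl divr_gt0// addr_gt0.
have := near_prob_gt (measurable_speed_event v) Qv (fun n => measurableC (mB n)) ev r1.
move=> [N _ /(_ N.+1 (leqnSn _))] /=.
rewrite (probability_setC Q (mB _)) fineB ?fin_num_measure//.
rewrite (prefix_prob lawQ) !fineEFin.
have n0 : 0 < N.+1%:R :> R by rewrite ltr0n.
have w1' p : 2^-1 <= w p <= 1 by case: p => x k; apply: w1.
have := @path_prob_last_ge R w (a * N.+1%:R) N.+1%:R N.+1 [::] 0 w1'.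
have Na : 0 < N.+1%:R + a * N.+1%:R by rewrite addr_gt0// mulr_gt0.
have E : (0%:~R + a * N.+1%:R) / (N.+1%:R + a * N.+1%:R) = a / (1 + a) :> R.
  by rewrite add0r -[X in X + _]mul1r -mulrDl -mulf_div divff ?mulr1//.
rewrite E {1}add0r lexx => /(_ Na isT); rewrite /h; set q := path_prob _ _ _ _ _; lra.
Unshelve. all: by end_near. Qed.

Lemma quenched_speed_mono (w1 w2 : Env R) (Q1 Q2 : probability PathSp R) (v1 v2 : R) :
  in_Omega_plus w1 -> in_Omega_plus w2 -> env_le w1 w2 ->
  is_ERW_law w1 Q1 -> is_ERW_law w2 Q2 ->
  Q1 (speed_event v1) = 1%E -> Q2 (speed_event v2) = 1%E -> v1 <= v2.
Proof.
move=> W1 W2 w12 law1 law2 Qv1 Qv2.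
have v20 := quenched_speed_ge0 W2 law2 Qv2.
rewrite leNgt; apply/negP => v21.
pose c := (v1 + v2) / 2.
have c0 : 0 < c by rewrite /c; lra.
have v2c : v2 < c by rewrite /c; lra.
have cv1 : c < v1 by rewrite /c; lra.
(* An integer is at least [K n] exactly when it is at least [c * n]. *)
pose K n := Num.ceil (c * n%:R).
pose A n : set PathSp := [set X : PathSp | has (fun x => K n <= x) (map X (iota 0 n.+1))].
have mA n : measurable (A n) by apply: (measurable_prefix (has (fun x => K n <= x))).
have ev1 (X : PathSp) : speed_event v1 X -> \forall n \near \oo, A n X.
  move=> /cvgr_gt /(_ c cv1) Xc; near=> n.
  rewrite /A /mkset map_iotaS has_rcons; apply/orP; left.
  have n0 : 0 < n%:R :> R by rewrite ltr0n; near: n; exists 1%N.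
  by rewrite /K ceil_le_int -ler_pdivlMr// ltW//; near: n; apply: Xc.
have ev2 (X : PathSp) : speed_event v2 X -> \forall n \near \oo, (~` A n) X.
  move=> /cvgr_lt /(_ c v2c) [M _ Xc].
  (* Positions up to time [M] are bounded by [B], which [c * n] eventually exceeds; later ones
     satisfy [X m < c * m <= c * n]. *)
  pose B : R := \sum_(m < M.+1) `|(X m)%:~R|.
  near=> n; rewrite /A /setC /mkset; apply/negP/hasPn => x /mapP[m].
  rewrite mem_iota add0n ltnS => /andP[_ mn] ->; rewrite -ltNge /K ceil_gt_int.
  have [mM|Mm] := ltnP m M.+1.
    apply: (@le_lt_trans _ _ B).
      rewrite /B (bigD1 (Ordinal mM))//= (le_trans (ler_norm _))// lerDl.
      exact: sumr_ge0.
    by rewrite mulrC -ltr_pdivrMr//; near: n; apply: nbhs_infty_gtr.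
  have m0 : 0 < m%:R :> R by rewrite ltr0n (leq_trans _ Mm).
  apply: (@lt_le_trans _ _ (c * m%:R)); last by rewrite ler_pM2l// ler_nat.
  by rewrite -ltr_pdivrMr//; apply: Xc => /=; apply: ltnW.
(* At a large horizon the hitting probability would exceed 1/2 for the first walk and be below 1/2
   for the second, against [path_prob_hit_mono]. *)
have half1 : 2^-1 < 1 :> R by lra.
have near1 := near_prob_gt (measurable_speed_event v1) Qv1 mA ev1 half1.
have near2 := near_prob_gt (measurable_speed_event v2) Qv2
  (fun n => measurableC (mA n)) ev2 half1.
have [N _ /(_ N.+1 (leqnSn _))] := filterI near1 near2; rewrite /setI /mkset.
rewrite (probability_setC Q2 (mA _)) fineB ?fin_num_measure//.
rewrite (prefix_prob law1) (prefix_prob law2) !fineEFin => -[].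
have K0 : 0 < K N.+1 by rewrite /K ceil_gt0 mulr_gt0.
have := @path_prob_hit_mono R w1 w2 (K N.+1) N.+1.
have ww p : 0 <= w1 p <= w2 p.
  case: p => x k; rewrite w12 andbT; have /andP[+ _] := W1 x k.
  by apply: le_trans; rewrite invr_ge0.
have w21 p : w2 p <= 1 by case: p => x k; have /andP[] := W2 x k.
move=> /(_ ww w21 K0); lra.
Unshelve. all: by end_near. Qed.

End quenched.

(** * Passing to random environments *)

Lemma measurable_bigcap_countable d (T : measurableType d) (I : countType)
    (F : I -> set T) : (forall i, measurable (F i)) -> measurable (\bigcap_i F i).
Proof.
move=> mF; rewrite -[X in measurable X]setCK setC_bigcap; apply: measurableC.
apply: countable_bigcupT_measurable; first exact: countableP.
by move=> i; apply: measurableC.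
Qed.

Lemma measurable_fun_env (R : realType) (i : int * nat) :
  measurable_fun setT (fun w : Env R => w i).
Proof.
by move=> _ B mB; rewrite setTI; apply: sub_sigma_algebra; exists i, B.
Qed.

Lemma probability1_ae d (T : measurableType d) (R : realType) (P : probability T R)
    (A : set T) : measurable A -> P A = 1%E -> {ae P, forall x, A x}.
Proof.
move=> mA PA; exists (~` A); split => //; first exact: measurableC.
by rewrite [LHS]probability_setC// PA subee.
Qed.

Theorem mainTheorem17 (R : realType)
    (Pbar : probability (Env R * Env R)%type R)
    (hOmega : Pbar [set p | in_Omega_plus p.1 /\ in_Omega_plus p.2] = 1%E)
    (hle : Pbar [set p | env_le p.1 p.2] = 1%E)
    (hstat1 : stationary_half Pbar fst) (herg1 : ergodic_half Pbar fst)
    (hstat2 : stationary_half Pbar snd) (herg2 : ergodic_half Pbar snd)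
    (Q : Env R -> probability (PathSp) R)
    (hQ : forall w : Env R, in_Omega_plus w -> is_ERW_law w (Q w))
    (v1 v2 : R)
    (hv1 : {ae Pbar, forall p, Q p.1 (speed_event v1) = 1%E})
    (hv2 : {ae Pbar, forall p, Q p.2 (speed_event v2) = 1%E}) :
  v1 <= v2.
Proof.
have m1 i : measurable_fun setT (fun p : Env R * Env R => p.1 i).
  exact: measurableT_comp (measurable_fun_env i) measurable_fst.
have m2 i : measurable_fun setT (fun p : Env R * Env R => p.2 i).
  exact: measurableT_comp (measurable_fun_env i) measurable_snd.
have mle : measurable [set p : Env R * Env R | env_le p.1 p.2].
  rewrite (_ : [set _ | _] = \bigcap_i [set p : Env R * Env R | p.1 i <= p.2 i]).
    apply: measurable_bigcap_countable => i; rewrite -[X in measurable X]setTI.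
    exact: measurable_fun_le.
  by apply/seteqP; split=> [p pP [x k] _|p pP x k]; [exact: pP|exact: (pP (x, k))].
have mO : measurable [set p : Env R * Env R | in_Omega_plus p.1 /\ in_Omega_plus p.2].
  rewrite (_ : [set _ | _] = \bigcap_i
      (([set p : Env R * Env R | 2^-1 <= p.1 i] `&` [set p | p.1 i <= 1]) `&`
       ([set p : Env R * Env R | 2^-1 <= p.2 i] `&` [set p | p.2 i <= 1]))).
    apply: measurable_bigcap_countable => i.
    by apply: measurableI; apply: measurableI; rewrite -[X in measurable X]setTI;
      apply: measurable_fun_le => //; apply: measurable_cst.
  apply/seteqP; split=> [p [p1 p2] [x k] _|p pP].
    by split; split; have /andP[? ?] := p1 x k; have /andP[? ?] := p2 x k.
  by split=> x k; have [] := pP (x, k) I => -[? ?] [? ?]; apply/andP.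
have aeO := probability1_ae mO hOmega; have aele := probability1_ae mle hle.
(* As [Pbar] has positive mass, the four almost sure properties hold together at some pair of
   environments; one such pair suffices because [v1] and [v2] are constants. *)
have Pbar0 : (0 < Pbar setT)%E by rewrite probability_setT.
have PF := ae_properfilter_algebraOfSetsType Pbar0.
have [p [ [ [om1 om2] p12] [Q1 Q2] ] ] := @filter_ex _ _ PF _
  (filterI (filterI aeO aele) (filterI hv1 hv2)).
exact: (quenched_speed_mono om1 om2 p12 (hQ _ om1) (hQ _ om2) Q1 Q2).
Qed.
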